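(* Let $q$ be a power of a prime $p$, and let $h(x) = x^6 + a_1 x^5 + a_2 x^4 + a_3 x^3 + a_2 q x^2 + a_1 q^2 x + q^3$ with $a_1,a_2,a_3 \in \mathbb{Z}$. Then $h(x) \in W_q(3)$ if and only if all of the following hold: (a) $|a_1| \leq 6\sqrt{q}$; (b* ) $4\sqrt{q}\,|a_1| - 9q \leq a_2$; (b) $a_2 \leq \frac{1}{3}a_1^2 + 3q$; (c) $-\frac{2}{27}a_1^3 + \frac{1}{3}a_1a_2 + qa_1 - \frac{2}{27}(a_1^2 - 3a_2 + 9q)^{3/2} \leq a_3 \leq -\frac{2}{27}a_1^3 + \frac{1}{3}a_1a_2 + qa_1 + \frac{2}{27}(a_1^2 - 3a_2 + 9q)^{3/2}$; (d) $-2qa_1 - 2\sqrt{q}\,a_2 - 2q\sqrt{q} \leq a_3 \leq -2qa_1 + 2\sqrt{q}\,a_2 + 2q\sqrt{q}$; where the quantity $a_1^2 - 3a_2 + 9q$ in (c) is a non-negative real number by (b). Moreover, a polynomial $h(x) \in W_q(3)$ has a real root if and only if at least one of the inequalities in (a), (b* ) or (d) is an equality. Explicitly, $h(x)$ lies in $W_q(3)$ and has a real root if and only if there are non-negative integers $k,\ell$ such that exactly one of the following (mutually exclusive) cases occurs: (I) $q$ is not a square and $h(x) = (x^2-q)^2 h_0(x)$ with $h_0(x) \in W_q(1)$; (II) $q$ is a square, $k+\ell = 3$ and $h(x) = (x+\sqrt{q})^{2k}(x-\sqrt{q})^{2\ell}$; (III) $q$ is a square, $k+\ell=2$ and $h(x)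 = (x+\sqrt{q})^{2k}(x-\sqrt{q})^{2\ell}h_0(x)$ with $h_0(x) \in W_q(1)$ having no real roots; (IV) $q$ is a square, $k+\ell = 1$ and $h(x) = (x+\sqrt{q})^{2k}(x-\sqrt{q})^{2\ell}h_0(x)$ with $h_0(x) \in W_q(2)$ having no real roots.
   Context: A $q$-Weil polynomial is a monic polynomial in $\mathbb{Z}[x]$ of even positive degree $2g$ whose set of complex roots has the form $\{w_1,\bar w_1,\ldots,w_g,\bar w_g\}$ with $|w_i| = \sqrt{q}$ for every $i$. $W_q(g)$ denotes the set of $q$-Weil polynomials of degree $2g$. For a positive real $r$, $\sqrt[n]{r} = r^{1/n}$ denotes the positive real $n$-th root (so $(\cdot)^{3/2}$ of a non-negative real is non-negative real). *)

(* Defs.v *)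
From mathcomp Require Import all_boot all_order all_algebra all_field.
Set Implicit Arguments. Unset Strict Implicit. Unset Printing Implicit Defensive.
Import Order.TTheory GRing.Theory Num.Theory.
Local Open Scope ring_scope.

(* Complex roots are taken in algC (algebraic complex numbers), which is
   algebraically closed and contains all roots of integer polynomials. *)

(* h : {poly int} is a q-Weil polynomial of degree 2g: g > 0 and
   h = prod_{i<g} (X - w_i)(X - conj w_i) over C with |w_i| = sqrt q
   (roots counted with multiplicity). Monicity and degree 2g follow. *)
Definition weil_poly (q g : nat) (h : {poly int}) : Prop :=
  (0 < g)%N /\
  exists w : 'I_g -> algC,
    map_poly (fun z : int => z%:~R) h =
      \prod_(i < g) (('X - (w i)%:P) * ('X - ((w i)^*)%:P)) /\
    forall i, `|w i| = sqrtC (q%:R : algC).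

(* h has a real root (a real complex root). *)
Definition has_real_root (h : {poly int}) : Prop :=
  exists x : algC, x \is Num.real /\ root (map_poly (fun z : int => z%:~R) h) x.

(* q is a perfect square of a natural number *)
Definition is_square (q : nat) : Prop := exists s : nat, q = (s ^ 2)%N.

(* Main.v *)
Require Import Defs.
From mathcomp Require Import all_boot all_order all_algebra all_field.
From mathcomp Require Import ring zify.
Import Order.TTheory GRing.Theory Num.Theory.
Local Open Scope ring_scope.

(* Write s for the square root of q. Pairing w with its conjugate, a polynomial
   is q-Weil iff it is a product of factors X^2 - x X + q whose traces x (w plus
   its conjugate) are real and lie in [-2s, 2s]. For h the three traces are the
   roots of a cubic f whose coefficients come from a1, a2, a3. They are all real iff the discriminant of f is nonnegative, which given (b) is (c); then
   they lie in [-2s, 2s] iff the elementary symmetric functions of the 2s - x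
   and of the 2s + x are nonnegative, which is (a), (b* ) and (d).
   A factor has a real root iff x = 2s or x = -2s, and this makes one of the
   elementary symmetric functions vanish. If q is a square, the factors
   (X - s)^2 and (X + s)^2 split off over the integers; otherwise the
   irrationality of s in an equality case of (d) forces a2 = - q and
   a3 = - 2 q a1, whence h = (X^2 - q)^2 (X^2 + a1 X + q). *)

Local Notation toC := (map_poly (intr : int -> algC)).

(** * Real and nonnegative roots of cubics *)

Lemma conj_root_cubic {C : numClosedFieldType} (x y z : C) :
  x + y + z \is Num.real -> x * y + x * z + y * z \is Num.real ->
  x * y * z \is Num.real -> (x^* - x) * (x^* - y) * (x^* - z) = 0.
Proof.
move=> /CrealP e1 /CrealP e2 /CrealP e3.
(* The product is the monic cubic with roots [x], [y], [z] evaluated at [x^*]. Its coefficients are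
   real, so this is the conjugate of its value at [x]. *)
have -> : (x^* - x) * (x^* - y) * (x^* - z) =
  x^* ^+ 3 - (x + y + z) * x^* ^+ 2 + (x * y + x * z + y * z) * x^* - x * y * z.
  by ring.
by rewrite -e1 -e2 -e3 !(rmorphD, rmorphM) /=; ring.
Qed.

(* [x - x^*] is purely imaginary, so a pair of conjugate roots would make the
   discriminant negative. *)
Lemma conj_pair_disc {C : numClosedFieldType} (x z : C) :
  x + x^* + z \is Num.real ->
  0 <= ((x - x^*) * (x - z) * (x^* - z)) ^+ 2 -> x \is Num.real.
Proof.
move=> /CrealP e1.
have zR : z^* = z.
  by move: e1; rewrite !rmorphD /= conjCK [x^* + x]addrC => /addrI.
have -> : ((x - x^*) * (x - z) * (x^* - z)) ^+ 2 =
          - ((x - x^*) * (x - x^*)^* * ((x - z) * (x - z)^*) ^+ 2).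
  by rewrite !rmorphB /= conjCK zR; ring.
rewrite -!normCK oppr_ge0 => le0.
have : `|x - x^*| ^+ 2 * (`|x - z| ^+ 2) ^+ 2 == 0.
  by rewrite eq_le le0 mulr_ge0 ?exprn_ge0.
rewrite mulf_eq0 !expf_eq0 /= !normr_eq0 !subr_eq0 => /orP[/eqP eqx|/eqP->].
  by apply/CrealP.
exact/CrealP.
Qed.

(** Conjugation sends [x] to a root, hence to [x], [y] or [z]; in the last two cases
    [conj_pair_disc] applies. *)
Lemma cubic_root_real {C : numClosedFieldType} (x y z : C) :
  x + y + z \is Num.real -> x * y + x * z + y * z \is Num.real ->
  x * y * z \is Num.real -> 0 <= ((x - y) * (x - z) * (y - z)) ^+ 2 ->
  x \is Num.real.
Proof.
move=> e1 e2 e3 disc; have /eqP := conj_root_cubic _ _ _ e1 e2 e3.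
rewrite !mulf_eq0 !subr_eq0 -orbA => /or3P[/eqP|/eqP|/eqP] eqx.
- exact/CrealP.
- by apply: (conj_pair_disc x z); rewrite eqx.
- apply: (conj_pair_disc x y); rewrite eqx; first by rewrite addrAC.
  rewrite [X in 0 <= X](_ : _ = ((x - y) * (x - z) * (y - z)) ^+ 2) //; ring.
Qed.

(** For negative [t] all four terms of the negated cubic are nonnegative and [- t ^+ 3] is positive,
    so the cubic cannot vanish. *)
Lemma cubic_root_ge0 {R : numDomainType} (t e1 e2 e3 : R) :
  t \is Num.real -> 0 <= e1 -> 0 <= e2 -> 0 <= e3 ->
  t ^+ 3 - e1 * t ^+ 2 + e2 * t - e3 = 0 -> 0 <= t.
Proof.
move=> tR e1_ge0 e2_ge0 e3_ge0 root_t.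
rewrite real_leNgt ?rpred0 //; apply/negP => t_lt0.
have: 0 < - t ^+ 3 + (e1 * t ^+ 2 + (e2 * - t + e3)).
  apply: ltr_pwDl; first by rewrite oppr_gt0 real_exprn_odd_lt0.
  apply: addr_ge0; first by rewrite mulr_ge0 ?real_exprn_even_ge0.
  by rewrite addr_ge0 // mulr_ge0 // oppr_ge0 ltW.
rewrite [X in 0 < X](_ : _ = - (t ^+ 3 - e1 * t ^+ 2 + e2 * t - e3)); last by ring.
by rewrite root_t oppr0 ltxx.
Qed.

Lemma esym3_ge0 {R : numDomainType} (x y z : R) :
  x \is Num.real -> y \is Num.real -> z \is Num.real ->
  0 <= x + y + z -> 0 <= x * y + x * z + y * z -> 0 <= x * y * z ->
  [/\ 0 <= x, 0 <= y & 0 <= z].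
Proof.
move=> xR yR zR e1 e2 e3.
by split; apply: (cubic_root_ge0 _ _ _ _ _ e1 e2 e3) => //; ring.
Qed.

(** Together with [esym2_eq0], this reduces equality in (a) or (b* ) to the vanishing of a product,
    as for (d). *)
Lemma esym1_eq0 {R : numDomainType} (x y z : R) :
  0 <= x -> 0 <= y -> 0 <= z -> x + y + z = 0 -> x * y * z = 0.
Proof.
move=> x0 y0 z0 /eqP; rewrite !paddr_eq0 ?addr_ge0 //.
by case/andP=> /andP[/eqP-> _] _; rewrite !mul0r.
Qed.

Lemma esym2_eq0 {R : numDomainType} (x y z : R) :
  0 <= x -> 0 <= y -> 0 <= z ->
  x * y + x * z + y * z = 0 -> x * y * z = 0.
Proof.
move=> x0 y0 z0 /eqP; rewrite !paddr_eq0 ?addr_ge0 ?mulr_ge0 //.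
by case/andP=> /andP[/eqP-> _] _; rewrite mul0r.
Qed.

(** * Three traces in [-2s, 2s] and the inequalities on the coefficients *)

Definition trace_itv {C : numClosedFieldType} (s x : C) :=
  (0 <= 2 * s - x) && (0 <= 2 * s + x).

(* [x], [y], [z] are the roots of [X^3 + A1 X^2 + (A2 - 3 q) X + (A3 - 2 q A1)],
   where [q = s^2]. *)
Definition cubic_traces {C : numClosedFieldType} (s A1 A2 A3 x y z : C) :=
  [/\ A1 = - (x + y + z), A2 = 3 * s ^+ 2 + (x * y + x * z + y * z) &
      A3 = 2 * s ^+ 2 * A1 - x * y * z].

Section Traces.
Variables (C : numClosedFieldType) (s : C).
Hypothesis s_ge0 : 0 <= s.

Local Notation trace_itv := (trace_itv s).

Let s_real : s \is Num.real. Proof. exact: ger0_real. Qed.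

(** The order on [C] is partial, and [0 <= u] holds only for real [u]. *)
Lemma trace_itv_real x : trace_itv x -> x \is Num.real.
Proof.
by case/andP=> /ger0_real + _; rewrite rpredBl ?realM ?realn.
Qed.

Variables (A1 A2 A3 : C).
Hypotheses (A1r : A1 \is Num.real) (A2r : A2 \is Num.real)
  (A3r : A3 \is Num.real).
(** Substituting X = T - A1/3 in the cubic of the traces gives T^3 - (D/3) T + (A3 - c0). *)
Let D : C := A1 ^+ 2 - 3 * A2 + 9 * s ^+ 2.
Let c0 : C := - (2 / 27) * A1 ^+ 3 + (1 / 3) * A1 * A2 + s ^+ 2 * A1.

Local Notation cubic_traces := (cubic_traces s A1 A2 A3).

(** The discriminant of T^3 + u T + v is -4 u^3 - 27 v^2; here u = -D/3 and v = A3 - c0, and the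
    factor 27 clears denominators. *)
Lemma cubic_discE x y z : cubic_traces x y z ->
  27 * ((x - y) * (x - z) * (y - z)) ^+ 2 = 4 * D ^+ 3 - 729 * (A3 - c0) ^+ 2.
Proof. by rewrite /D /c0; case=> -> -> ->; field. Qed.

Lemma sqrtC_cubeP : 0 <= D ->
  (c0 - (2 / 27) * sqrtC D ^+ 3 <= A3 /\ A3 <= c0 + (2 / 27) * sqrtC D ^+ 3)
  <-> 0 <= 4 * D ^+ 3 - 729 * (A3 - c0) ^+ 2.
Proof.
move=> D0; have c0r : c0 \is Num.real
  by rewrite /c0 !(realD, realM, realX, realN, realV, realn, real1).
set r := sqrtC D; have r0 : 0 <= r by rewrite sqrtC_ge0.
have R0 : 0 <= 2 / 27 * r ^+ 3 by rewrite mulr_ge0 ?divr_ge0 ?exprn_ge0 ?ler0n.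
(* Since 729 = 27^2, the term 4 D^3 is 729 times the square of (2/27) D^(3/2), so the sign compares
   [A3 - c0] with this bound in absolute value. *)
have -> : 4 * D ^+ 3 - 729 * (A3 - c0) ^+ 2 =
  729 * ((2 / 27 * r ^+ 3) ^+ 2 - (A3 - c0) ^+ 2).
  by rewrite -(sqrtCK D) -/r; field.
rewrite pmulr_rge0 ?ltr0n // subr_ge0 -real_normK ?rpredB //.
rewrite ler_pXn2r ?nnegrE // real_ler_norml ?rpredB //.
rewrite lerBrDl [A3 - c0 <= _]lerBlDl.
by split => [[-> ->]//|/andP].
Qed.

Lemma cubic_traces_exist : exists x y z, cubic_traces x y z.
Proof.
pose c := [:: A3 - 2 * s ^+ 2 * A1; A2 - 3 * s ^+ 2; A1; 1].
have c_last : last 1 c != 0 by rewrite oner_eq0.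
have [r def_r] := closed_field_poly_normal (Poly c).
have lead1 : lead_coef (Poly c) = 1 by rewrite lead_coefE (PolyK c_last).
move: def_r; rewrite lead1 scale1r.
have : size (Poly c) = 4 by rewrite (PolyK c_last).
move=> /[swap] def_r; rewrite {1}def_r size_prod_XsubC => -[].
case: r def_r => [|x [|y [|z []]]] def_r //= _.
exists x, y, z.
(* Both coefficient lists end in 1, so [PolyK] turns equality of the polynomials into equality of
   the entries. *)
pose d := [:: - (x * y * z); x * y + x * z + y * z; - (x + y + z); 1].
have d_last : last 1 d != 0 by rewrite oner_eq0.
have : Poly c = Poly d.
  by rewrite def_r !big_cons big_nil /= !cons_poly_def; ring.
move/(congr1 polyseq); rewrite (PolyK c_last) (PolyK d_last) => -[e3 e2 e1].
by split; rewrite -?e1 //; [rewrite -e2 | rewrite -[x * y * z]opprK -e3]; ring.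
Qed.

(** The right-hand sides are the differences between the two sides of (a), (b* ) and (d), with each
    absolute value opened into its two signs. *)
Lemma cubic_traces_shift x y z : cubic_traces x y z ->
  [/\ (2 * s - x) + (2 * s - y) + (2 * s - z) = 6 * s + A1,
      (2 * s - x) * (2 * s - y) + (2 * s - x) * (2 * s - z)
        + (2 * s - y) * (2 * s - z) = 4 * s * A1 + (A2 + 9 * s ^+ 2) &
      (2 * s - x) * (2 * s - y) * (2 * s - z) =
        A3 - (- 2 * s ^+ 2 * A1 - 2 * s * A2 - 2 * s ^+ 2 * s)] /\
  [/\ (2 * s + x) + (2 * s + y) + (2 * s + z) = 6 * s - A1,
      (2 * s + x) * (2 * s + y) + (2 * s + x) * (2 * s + z)
        + (2 * s + y) * (2 * s + z) = A2 + 9 * s ^+ 2 - 4 * s * A1 &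
      (2 * s + x) * (2 * s + y) * (2 * s + z) =
        - 2 * s ^+ 2 * A1 + 2 * s * A2 + 2 * s ^+ 2 * s - A3].
Proof. by case=> -> -> ->; split; split; ring. Qed.

Let sA1_norm : 4 * s * `|A1| = `|4 * s * A1|.
Proof. by rewrite normrM ger0_norm ?mulr_ge0 ?ler0n. Qed.

Let sA1_real : 4 * s * A1 \is Num.real.
Proof. by rewrite !realM ?realn. Qed.

Theorem cubic_tracesP :
 (exists x y z, [/\ trace_itv x, trace_itv y, trace_itv z & cubic_traces x y z])
 <->
 [/\ `|A1| <= 6 * s, 4 * s * `|A1| - 9 * s ^+ 2 <= A2,
     A2 <= (1 / 3) * A1 ^+ 2 + 3 * s ^+ 2,
     (c0 - (2 / 27) * sqrtC D ^+ 3 <= A3 /\ A3 <= c0 + (2 / 27) * sqrtC D ^+ 3) &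
     - 2 * s ^+ 2 * A1 - 2 * s * A2 - 2 * s ^+ 2 * s <= A3 /\
     A3 <= - 2 * s ^+ 2 * A1 + 2 * s * A2 + 2 * s ^+ 2 * s].
Proof.
have condb : (A2 <= 1 / 3 * A1 ^+ 2 + 3 * s ^+ 2) = (0 <= D).
  rewrite -subr_ge0 (_ : 1 / 3 * A1 ^+ 2 + 3 * s ^+ 2 - A2 = 3^-1 * D).
    by rewrite pmulr_rge0 ?invr_gt0 ?ltr0n.
  by rewrite /D; field.
(* This brings (a), (b* ) and (d) to the nonnegativity of the six quantities of
   [cubic_traces_shift]. *)
rewrite sA1_norm lerBlDr !real_ler_norml //.
rewrite -[- (6 * s) <= _]subr_ge0 -[_ <= 6 * s]subr_ge0.
rewrite -[- _ <= 4 * s * A1]subr_ge0 -[4 * s * A1 <= _]subr_ge0 !opprK.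
rewrite -[- 2 * _ * _ - _ - _ <= A3]subr_ge0 -[A3 <= - 2 * _ * _ + _ + _]subr_ge0.
rewrite [A1 + 6 * s]addrC.
split=> [[x [y [z [xi yi zi tr]]]]|[/andP[a1 a2] /andP[b1 b2] b c [d1 d2]]].
  have [xr yr zr] := And3 (trace_itv_real _ xi) (trace_itv_real _ yi)
    (trace_itv_real _ zi).
  have [[<- <- <-] [<- <- <-]] := cubic_traces_shift _ _ _ tr.
  move: xi yi zi => /andP[x0 x1] /andP[y0 y1] /andP[z0 z1].
  have D0 : 0 <= D.
    rewrite (_ : D = 2^-1 * ((x - y) ^+ 2 + (x - z) ^+ 2 + (y - z) ^+ 2)).
      by rewrite mulr_ge0 ?invr_ge0 ?ler0n ?addr_ge0 // real_exprn_even_ge0 ?realB.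
    by rewrite /D; case: tr => -> -> _; field.
  have disc : 0 <= 27 * ((x - y) * (x - z) * (y - z)) ^+ 2.
    by rewrite mulr_ge0 ?ler0n // real_exprn_even_ge0 // !realM ?realB.
  have esym_ge0 (a b c : C) : 0 <= a -> 0 <= b -> 0 <= c ->
      [/\ 0 <= a + b + c, 0 <= a * b + a * c + b * c & 0 <= a * b * c].
    by move=> a0 b0 c0'; rewrite !addr_ge0 ?mulr_ge0.
  have [-> -> ->] := esym_ge0 _ _ _ x0 y0 z0.
  have [-> -> ->] := esym_ge0 _ _ _ x1 y1 z1.
  rewrite condb; split=> //; apply/(sqrtC_cubeP D0).
  by rewrite -(cubic_discE _ _ _ tr).
have [x [y [z tr]]] := cubic_traces_exist; exists x, y, z.
move: b; rewrite condb => D0; move: c => /(sqrtC_cubeP D0).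
rewrite -(cubic_discE _ _ _ tr).
rewrite pmulr_rge0 ?ltr0n // => disc.
have [e1 e2 e3] : [/\ x + y + z \is Num.real, x * y + x * z + y * z \is Num.real
                    & x * y * z \is Num.real].
  case: tr => E1 E2 E3; split.
  - by rewrite -[_ + z]opprK -E1 rpredN.
  - by rewrite (_ : _ + _ + _ = A2 - 3 * s ^+ 2)
            ?realB ?realM ?realX ?realn // E2; ring.
  by rewrite (_ : _ * z = 2 * s ^+ 2 * A1 - A3)
          ?realB ?realM ?realX ?realn // E3; ring.
(* The hypotheses of [cubic_root_real] are symmetric in the roots, so cyclic permutations handle [y]
   and [z]. *)
have [xr yr zr] : [/\ x \is Num.real, y \is Num.real & z \is Num.real].
  split; first exact: cubic_root_real disc.
  - apply: (cubic_root_real y z x).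
    + by rewrite (_ : y + z + x = x + y + z) //; ring.
    + by rewrite (_ : _ + _ + _ = x * y + x * z + y * z) //; ring.
    + by rewrite (_ : y * z * x = x * y * z) //; ring.
    by rewrite [X in 0 <= X](_ : _ = ((x - y) * (x - z) * (y - z)) ^+ 2) //; ring.
  - apply: (cubic_root_real z x y).
    + by rewrite (_ : z + x + y = x + y + z) //; ring.
    + by rewrite (_ : _ + _ + _ = x * y + x * z + y * z) //; ring.
    + by rewrite (_ : z * x * y = x * y * z) //; ring.
    by rewrite [X in 0 <= X](_ : _ = ((x - y) * (x - z) * (y - z)) ^+ 2) //; ring.
move: a1 a2 b1 b2 d1 d2; have [[<- <- <-] [<- <- <-]] := cubic_traces_shift _ _ _ tr.
move=> a1 a2 b1 b2 d1 d2.
have ur t : t \is Num.real -> 2 * s - t \is Num.real.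
  by move=> ?; rewrite realB ?realM ?realn.
have vr t : t \is Num.real -> 2 * s + t \is Num.real.
  by move=> ?; rewrite realD ?realM ?realn.
have [//|//|//|x0 y0 z0] := esym3_ge0 _ _ _ (ur x _) (ur y _) (ur z _) a1 b1 d1.
have [//|//|//|x1 y1 z1] := esym3_ge0 _ _ _ (vr x _) (vr y _) (vr z _) a2 b2 d2.
by split=> //; apply/andP.
Qed.

(** Equality in (a) or (b* ) makes a lower symmetric function vanish, that of the 2s + x if [A1] is
    nonnegative and that of the 2s - x otherwise. Its terms being nonnegative, the product vanishes
    too. *)
Lemma boundary_traceP x y z :
  trace_itv x -> trace_itv y -> trace_itv z -> cubic_traces x y z ->
  [\/ `|A1| = 6 * s, 4 * s * `|A1| - 9 * s ^+ 2 = A2,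
     - 2 * s ^+ 2 * A1 - 2 * s * A2 - 2 * s ^+ 2 * s = A3 |
     A3 = - 2 * s ^+ 2 * A1 + 2 * s * A2 + 2 * s ^+ 2 * s] <->
  (2 * s - x) * (2 * s - y) * (2 * s - z) = 0 \/
  (2 * s + x) * (2 * s + y) * (2 * s + z) = 0.
Proof.
move=> /andP[x0 x1] /andP[y0 y1] /andP[z0 z1] tr.
have [[u1 u2 u3] [v1 v2 v3]] := cubic_traces_shift _ _ _ tr.
split; last first.
  rewrite u3 v3 => -[/eqP|/eqP]; rewrite subr_eq0 => /eqP E.
    by constructor 3.
  by constructor 4.
case=> [E|E|E|E]; [..|by left; rewrite u3 E subrr|by right; rewrite v3 E subrr].
- have [A1_ge0|A1_lt0] := real_ge0P A1r.
    right; rewrite ger0_norm // in E; apply: esym1_eq0 => //.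
    by rewrite v1 -E subrr.
  left; rewrite ltr0_norm // in E; apply: esym1_eq0 => //.
  by rewrite u1 -E addNr.
- have [A1_ge0|A1_lt0] := real_ge0P A1r.
    right; rewrite ger0_norm // in E; apply: esym2_eq0 => //.
    by rewrite v2 -E; ring.
  left; rewrite ltr0_norm // in E; apply: esym2_eq0 => //.
  by rewrite u2 -E; ring.
Qed.
End Traces.
Arguments trace_itv_real {C s}.

(** * Weil polynomials as products of quadratics with given traces *)

Lemma conj_trace_itv (w s : algC) : `|w| = s -> trace_itv s (w + w^*).
Proof.
move=> ws; have wr : w + w^* \is Num.real.
  by apply/CrealP; rewrite rmorphD /= conjCK addrC.
have : `|w + w^*| <= 2 * s.
  by rewrite (le_trans (ler_normD _ _)) // norm_conjC ws [2]mulr2n mulrDl mul1r.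
rewrite real_ler_norml // /trace_itv => /andP[ge le].
by rewrite subr_ge0 le -[0 <= _ + _]subr_ge0 subr0 -lerBlDl sub0r.
Qed.

Lemma trace_itv_conj (s x : algC) : 0 <= s -> trace_itv s x ->
  exists2 w, w + w^* = x & `|w| = s.
Proof.
move=> s0 xi; have xr := trace_itv_real s0 _ xi.
case/andP: xi => u0 v0.
(* The quadratic formula for X^2 - x X + s^2: its discriminant is - y^2 with [y] real, so the two
   roots are conjugate. *)
pose y := sqrtC ((2 * s - x) * (2 * s + x)).
have yr : y \is Num.real by rewrite sqrtC_real ?mulr_ge0.
pose w := (x + 'i * y) / 2.
have wc : w^* = (x - 'i * y) / 2.
  by rewrite /w rmorphM fmorphV /= conjC_rect // conjC_nat.
exists w; first by rewrite wc /w; field.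
apply/eqP; rewrite -(eqrXn2 (n := 2)) ?normr_ge0 // normCK wc.
rewrite (_ : w * _ = (x ^+ 2 - 'i ^+ 2 * y ^+ 2) / 4); last by rewrite /w; field.
by rewrite sqrCi sqrtCK; apply/eqP; field.
Qed.

Definition trace_quad (q : nat) (x : algC) : {poly algC} :=
  'X^2 - x%:P * 'X + (q%:R)%:P.

(** Unlike [weil_poly], this admits [g = 0], with [h = 1], as a base for inductions that remove one
    factor at a time. *)
Definition has_traces (q g : nat) (h : {poly int}) (xs : seq algC) :=
  [/\ size xs = g, all (trace_itv (sqrtC q%:R)) xs &
      toC h = \prod_(x <- xs) trace_quad q x].

Lemma sqrtCn_ge0 (q : nat) : 0 <= sqrtC q%:R :> algC.
Proof. by rewrite sqrtC_ge0. Qed.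

Lemma trace_quad_conj q (w : algC) : `|w| = sqrtC q%:R ->
  trace_quad q (w + w^*) = ('X - w%:P) * ('X - w^*%:P).
Proof.
move=> wq.
have -> : trace_quad q (w + w^*) =
    'X^2 - (w + w^*)%:P * 'X + (w * w^*)%:P.
  by rewrite -normCK wq sqrtCK.
by ring.
Qed.

Lemma weil_polyP q g h :
  weil_poly q g h <-> (0 < g)%N /\ exists xs, has_traces q g h xs.
Proof.
split=> -[g0].
  case=> w [hw wq]; split=> //; exists [seq w i + (w i)^* | i <- enum 'I_g].
  split.
  - by rewrite size_map size_enum_ord.
  - by apply/allP => x /mapP[i _ ->]; apply: conj_trace_itv.
  - rewrite big_map big_enum hw; apply: eq_bigr => i _.
    by rewrite trace_quad_conj.
case=> xs [sz /allP xi hx]; split=> //.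
(* The membership condition sits under the quantifier so that [fin_all_exists] can choose a root per
   index; 0 is a placeholder outside [xs]. *)
have lift_w x : exists w, x \in xs -> w + w^* = x /\ `|w| = sqrtC q%:R.
  have [xin|xnin] := boolP (x \in xs); last by exists 0.
  by have [w] := trace_itv_conj _ _ (sqrtCn_ge0 q) (xi x xin); exists w.
have [w wP] := fin_all_exists (fun i : 'I_g => lift_w (nth 0 xs i)).
have {}wP i : w i + (w i)^* = nth 0 xs i /\ `|w i| = sqrtC q%:R.
  by apply: wP; rewrite mem_nth // sz.
exists w; split=> [|i]; last by case: (wP i).
rewrite hx (big_nth 0) sz big_mkord; apply: eq_bigr => i _.
by case: (wP i) => <- /trace_quad_conj.
Qed.

Lemma has_tracesM q g1 g2 h1 h2 xs1 xs2 :
  has_traces q g1 h1 xs1 -> has_traces q g2 h2 xs2 ->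
  has_traces q (g1 + g2) (h1 * h2) (xs1 ++ xs2).
Proof.
move=> [<- all1 e1] [<- all2 e2].
by split; rewrite ?size_cat ?all_cat ?all1 // rmorphM /= e1 e2 big_cat.
Qed.

(** If [r] is a root of the factor of trace [x], then (2r - x)^2 is its discriminant x^2 - 4q, which
    is at most 0 on the interval; for real [r] it is also a square of a real, hence 0. Conversely,
    trace 2s or -2s gives the double root s or -s. *)
Lemma real_rootP q g h xs : has_traces q g h xs ->
  has_real_root h <->
  exists2 x, x \in xs & (2 * sqrtC q%:R - x) * (2 * sqrtC q%:R + x) = 0.
Proof.
move=> [_ /allP xi hx]; set s := sqrtC _.
have s0 : 0 <= s := sqrtCn_ge0 q.
split.
  case=> r [rr]; rewrite hx rootE horner_prod prodf_seq_eq0 => /hasP[x xin] /eqP.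
  have /andP[u0 v0] := xi x xin; have xr := trace_itv_real s0 _ (xi x xin).
  rewrite /trace_quad !hornerE -(sqrtCK q%:R) -/s => rE; exists x => //.
  have sqE : (2 * s - x) * (2 * s + x) = - (2 * r - x) ^+ 2.
    apply/eqP; rewrite -subr_eq0 opprK -[X in _ == X](mulr0 4) -rE.
    by apply/eqP; ring.
  apply/eqP; rewrite eq_le mulr_ge0 // andbT sqE oppr_le0 real_exprn_even_ge0 //.
  by rewrite realB // realM ?realn.
case=> x xin /eqP; rewrite mulf_eq0 => bd.
have [e er ex] : exists2 e : algC, e \is Num.real & x = 2 * e /\ e ^+ 2 = q%:R.
  case/orP: bd => [/eqP/subr0_eq xe|].
    by exists s; rewrite ?ger0_real // -xe sqrtCK.
  rewrite addrC addr_eq0 => /eqP xe; exists (- s); first by rewrite realN ger0_real.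
  by rewrite mulrN -xe sqrrN sqrtCK.
exists e; split=> //; rewrite hx rootE horner_prod prodf_seq_eq0.
apply/hasP; exists x => //.
case: ex => -> e2; apply/eqP; rewrite /trace_quad !hornerE -e2; ring.
Qed.

(** * Splitting off integral double roots when q is a square *)

Lemma trace_quad_sqr (q : nat) (e : int) : e ^+ 2 = q%:Z ->
  trace_quad q (2 * e%:~R) = toC (('X - e%:P) ^+ 2).
Proof.
move=> eq; rewrite rmorphXn rmorphB /= map_polyX map_polyC /= /trace_quad.
by rewrite -[q%:R]/(q%:Z%:~R) -eq rmorphXn /=; ring.
Qed.

(** Division by the monic [d] stays over the integers. Over [algC], [d] divides [h] and hence the
    remainder, which is smaller than [d] and so is 0. *)
Lemma split_trace q g h xs (e : int) : e ^+ 2 = q%:Z ->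
  has_traces q g.+1 h xs -> 2 * e%:~R \in xs ->
  exists2 h0, h = ('X - e%:P) ^+ 2 * h0 & exists ys, has_traces q g h0 ys.
Proof.
move=> eq [sz /allP xi hx] xin; set d := ('X - e%:P) ^+ 2.
have d_monic : d \is monic by rewrite rpredX // monicXsubC.
have := Pdiv.RingMonic.rdivp_eq d_monic h.
set h0 := Pdiv.CommonRing.rdivp h d; set r := Pdiv.CommonRing.rmodp h d.
have intr_inj : injective (intr : int -> algC) := intr_inj.
have map_inj : injective (toC) by apply: map_inj_poly.
move=> hE; have := hx; rewrite (big_rem _ xin) /= trace_quad_sqr // -/d.
set P := \prod_(_ <- _) _ => hxE.
have r0 : r = 0.
  apply: map_inj; rewrite rmorph0; apply/eqP/contraT => rn0.
  have : toC d %| toC r.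
    have -> : r = h - h0 * d by rewrite {1}hE addrC addKr.
    rewrite rmorphB /= hxE [h0 * d]mulrC (rmorphM _ d) /= -mulrBr.
    exact: dvdp_mulr.
  move/(dvdp_leq rn0); rewrite !size_map_inj_poly // leqNgt.
  by rewrite Pdiv.CommonRing.ltn_rmodpN0 // monic_neq0.
exists h0; first by rewrite {1}hE r0 addr0 mulrC.
exists (rem (2 * e%:~R) xs); split.
- by rewrite size_rem // sz.
- by apply/allP => x /mem_rem /xi.
have /mulfI : toC d != 0.
  by rewrite -(rmorph0 (toC)) (inj_eq map_inj) monic_neq0.
by apply; rewrite -hxE hE r0 addr0 (mulrC h0) (rmorphM _ d).
Qed.

Lemma has_traces1 q : has_traces q 0 1 [::].
Proof. by split; rewrite ?big_nil ?rmorph1. Qed.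

Lemma has_traces0_inv q h xs : has_traces q 0 h xs -> h = 1.
Proof.
case=> /size0nil -> _; rewrite big_nil => hE.
apply: (map_inj_poly (@intr_inj algC)) => //.
by rewrite hE; apply/esym/rmorph1.
Qed.

Lemma trace_itv_endpoint (s e : algC) : e = s \/ e = - s -> 0 <= s ->
  trace_itv s (2 * e).
Proof.
have E4 : 2 * s + 2 * s = 4 * s by ring.
by case=> -> s0; rewrite /trace_itv ?mulrN ?opprK subrr lexx E4 ?mulr_ge0.
Qed.

Lemma has_traces_sqr q (e : int) : e ^+ 2 = q%:Z ->
  has_traces q 1 (('X - e%:P) ^+ 2) [:: 2 * e%:~R].
Proof.
move=> eq; split=> //; last by rewrite big_seq1 trace_quad_sqr.
rewrite /= andbT trace_itv_endpoint ?sqrtCn_ge0 //.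
have : (e%:~R : algC) ^+ 2 == sqrtC q%:R ^+ 2 by rewrite sqrtCK -rmorphXn eq.
by rewrite eqf_sqr => /orP[/eqP|/eqP]; [left|right].
Qed.

Lemma has_traces_pow q (e : int) n : e ^+ 2 = q%:Z ->
  exists xs, has_traces q n (('X - e%:P) ^+ (2 * n)) xs.
Proof.
move=> eq; elim: n => [|n [xs IH]].
  by exists [::]; rewrite muln0 expr0; apply: has_traces1.
exists ([:: 2 * e%:~R] ++ xs); rewrite mulnS exprD -[n.+1]add1n.
exact: has_tracesM (has_traces_sqr _ _ eq) IH.
Qed.

Lemma sqrtC_sqrn (s : nat) : sqrtC (s ^ 2)%:R = s%:R :> algC.
Proof. by rewrite natrX sqrCK. Qed.

Lemma XaddC (s : int) : 'X + s%:P = 'X - (- s)%:P :> {poly int}.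
Proof. by rewrite rmorphN /= opprK. Qed.

Definition endpoint_pow (s k l : nat) : {poly int} :=
  ('X + (s%:Z)%:P) ^+ (2 * k) * ('X - (s%:Z)%:P) ^+ (2 * l).

Lemma endpoint_pow_traces (s k l : nat) :
  exists xs, has_traces (s ^ 2) (k + l) (endpoint_pow s k l) xs.
Proof.
have eq : s%:Z ^+ 2 = (s ^ 2)%:Z by [].
have [xs1 T1] := has_traces_pow (s ^ 2) (- s%:Z) k (etrans (sqrrN _) eq).
have [xs2 T2] := has_traces_pow (s ^ 2) s%:Z l eq.
exists (xs1 ++ xs2); rewrite /endpoint_pow XaddC; exact: has_tracesM.
Qed.

Lemma endpoint_pow_root (s k l : nat) h : (0 < k + l)%N ->
  has_real_root (endpoint_pow s k l * h).
Proof.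
rewrite addn_gt0 => kl; pose e : int := if (0 < k)%N then - s%:Z else s%:Z.
exists (e%:~R : algC); split; first by rewrite realz.
rewrite rmorphM rootM rmorphM /= rootM /e.
case: posnP kl => /= [_ l0|k0 _].
  apply/orP; left; apply/orP; right.
  rewrite rmorphXn rmorphB /= map_polyX map_polyC /= rootE.
  by rewrite !hornerE subrr expf_eq0 eqxx muln_gt0 l0.
apply/orP; left; apply/orP; left.
rewrite rmorphXn rmorphD /= map_polyX map_polyC /= rootE.
by rewrite !hornerE rmorphN addNr expf_eq0 eqxx muln_gt0 k0.
Qed.

(** Each trace 2s or -2s is removed by [split_trace]; once none is left, [real_rootP] excludes real
    roots. *)
Lemma endpoint_decomposition (s g : nat) h xs : has_traces (s ^ 2) g h xs ->
  exists k l g' h0, [/\ (k + l + g')%N = g, h = endpoint_pow s k l * h0,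
    exists ys, has_traces (s ^ 2) g' h0 ys & ~ has_real_root h0].
Proof.
elim: g h xs => [|g IHg] h xs T.
  exists 0%N, 0%N, 0%N, h; split=> //; first by rewrite /endpoint_pow !expr0 !mul1r.
    by exists xs.
  by move/(real_rootP _ _ _ _ T) => [x]; case: T => /size0nil ->.
have eq : s%:Z ^+ 2 = (s ^ 2)%:Z by [].
have [x2|xn2] := boolP (2 * (s%:Z)%:~R \in xs).
  have [h1 -> [ys T1]] := split_trace _ _ _ _ _ eq T x2.
  have [k [l [g' [h0 [<- -> T0 nr]]]]] := IHg _ _ T1.
  exists k, l.+1, g', h0; split=> //; first by rewrite addnS.
  by rewrite /endpoint_pow [(2 * l.+1)%N]mulnS exprD; ring.
have [x3|xn3] := boolP (2 * (- s%:Z)%:~R \in xs).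
  have [h1 -> [ys T1]] := split_trace _ _ _ _ _ (etrans (sqrrN _) eq) T x3.
  have [k [l [g' [h0 [<- -> T0 nr]]]]] := IHg _ _ T1.
  exists k.+1, l, g', h0; split=> //.
  by rewrite -XaddC /endpoint_pow [(2 * k.+1)%N]mulnS exprD; ring.
exists 0%N, 0%N, g.+1, h; split=> //; first by rewrite /endpoint_pow !expr0 !mul1r.
  by exists xs.
move/(real_rootP _ _ _ _ T) => [x xin /eqP]; rewrite sqrtC_sqrn mulf_eq0.
move=> /orP[/eqP/subr0_eq xE|]; first by rewrite -pmulrn xE xin in xn2.
rewrite addrC addr_eq0 => /eqP xE.
by rewrite rmorphN /= -pmulrn mulrN -xE xin in xn3.
Qed.

(** * The sextic in terms of its traces, and its factorization for non-square q *)

Lemma nonsquare_indep (q : nat) (a b : int) : ~ is_square q ->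
  a%:~R + b%:~R * sqrtC q%:R = 0 :> algC -> a = 0 /\ b = 0.
Proof.
move=> nsq E; suff b0 : b = 0.
  by split=> //; move: E; rewrite b0 mul0r addr0 => /eqP; rewrite intr_eq0 => /eqP.
apply/eqP; apply: contra_notT nsq => bn0.
(* For nonzero [b] this makes [b] divide [a], and [q] is the square of the quotient. *)
have E2 : a ^+ 2 = b ^+ 2 * q%:Z.
  apply: (@intr_inj algC); rewrite !intrM -pmulrn -!expr2.
  rewrite -(sqrtCK q%:R) -exprMn -[a%:~R](addrK (b%:~R * sqrtC q%:R)).
  by rewrite E sub0r sqrrN.
have E3 : (`|a| ^ 2 = `|b| ^ 2 * q)%N.
  by have := congr1 absz E2; rewrite abszM !abszX.
have b_gt0 : (0 < `|b|)%N by rewrite absz_gt0.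
have /dvdnP[c ac] : (`|b| %| `|a|)%N.
  by rewrite -(dvdn_pexp2r _ _ (k := 2)) // E3 dvdn_mulr.
exists c; apply/eqP; rewrite -(eqn_pmul2l (m := `|b| ^ 2)) ?expn_gt0 ?b_gt0 //.
by rewrite -E3 ac expnMn mulnC.
Qed.

Definition sextic (q : nat) (a1 a2 a3 : int) : {poly int} :=
  'X^6 + a1%:P * 'X^5 + a2%:P * 'X^4 + a3%:P * 'X^3
    + (a2 * q%:Z)%:P * 'X^2 + (a1 * (q%:Z) ^+ 2)%:P * 'X + ((q%:Z) ^+ 3)%:P.

Lemma sextic_traces (q : nat) (a1 a2 a3 : int) (xs : seq algC) :
  has_traces q 3 (sextic q a1 a2 a3) xs <->
  exists x y z, [/\ xs = [:: x; y; z],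
    [/\ trace_itv (sqrtC q%:R) x, trace_itv (sqrtC q%:R) y &
        trace_itv (sqrtC q%:R) z] &
    cubic_traces (sqrtC q%:R) a1%:~R a2%:~R a3%:~R x y z].
Proof.
pose A1 : algC := a1%:~R; pose A2 : algC := a2%:~R; pose A3 : algC := a3%:~R.
pose Q : algC := q%:R.
pose c := [:: Q ^+ 3; A1 * Q ^+ 2; A2 * Q; A3; A2; A1; 1].
have cl : last 1 c != 0 by rewrite oner_eq0.
have mapE : toC (sextic q a1 a2 a3) = Poly c.
  rewrite /sextic !(rmorphD, rmorphM, rmorphXn) /= !map_polyC map_polyX /=.
  by rewrite !cons_poly_def -!pmulrn; ring.
pose d x y z := let e1 := - (x + y + z) in
  let e2 := 3 * Q + (x * y + x * z + y * z) in
  [:: Q ^+ 3; e1 * Q ^+ 2; e2 * Q; 2 * Q * e1 - x * y * z; e2; e1; 1].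
have dl x y z : last 1 (d x y z) != 0 by rewrite oner_eq0.
have prodE x y z : \prod_(t <- [:: x; y; z]) trace_quad q t = Poly (d x y z).
  by rewrite !big_cons big_nil /trace_quad /= !cons_poly_def; ring.
rewrite /has_traces mapE /cubic_traces sqrtCK; split.
  case: xs => [|x [|y [|z [|t xs]]]] [] // _.
  rewrite [all _ _]/= => /and4P[xi yi zi _].
  rewrite prodE => /(congr1 polyseq); rewrite (PolyK cl) (PolyK (dl x y z)).
  (* The discarded equations, for X and X^2, are those for X^5 and X^4 multiplied by q^2 and q. *)
  case=> _ _ E3 E2 E1.
  by exists x, y, z; split=> //; split=> //; rewrite -/A1 E1.
case=> x [y [z [-> [xi yi zi] [E1 E2 E3]]]]; split=> //.
  by rewrite /= xi yi zi.
by rewrite prodE; congr Poly; rewrite /c /d /A1 /A2 /A3 E3 E2 E1.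
Qed.

Lemma sqr_sub_traces (q : nat) :
  has_traces q 2 (('X^2 - (q%:Z)%:P) ^+ 2)
    [:: 2 * sqrtC q%:R; 2 * - sqrtC q%:R].
Proof.
have s0 := sqrtCn_ge0 q; split=> //.
  rewrite /= (trace_itv_endpoint _ _ (or_introl erefl) s0).
  by rewrite (trace_itv_endpoint _ _ (or_intror erefl) s0).
rewrite !big_cons big_nil /trace_quad rmorphXn rmorphB rmorphXn /=.
rewrite map_polyX map_polyC /=.
by rewrite -pmulrn; set s := sqrtC _; rewrite -[q%:R]sqrtCK -/s; ring.
Qed.

(** Passes from the criterion of [real_rootP], sorted by trace, to that of [boundary_traceP], sorted
    by end of the interval. *)
Lemma trace_boundary3 (s x y z : algC) :
  (exists2 t, t \in [:: x; y; z] & (2 * s - t) * (2 * s + t) = 0) <->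
  (2 * s - x) * (2 * s - y) * (2 * s - z) = 0 \/
  (2 * s + x) * (2 * s + y) * (2 * s + z) = 0.
Proof.
split.
  case=> t + /eqP; rewrite !inE mulf_eq0 => /or3P[] /eqP-> /orP[] /eqP E;
    solve [left; rewrite E ?mulr0 ?mul0r ?mul0r //
          |right; rewrite E ?mulr0 ?mul0r ?mul0r //].
case=> /eqP; rewrite !mulf_eq0 => /orP[/orP[]|] /eqP E;
  solve [exists x; rewrite ?inE ?eqxx ?orbT // E ?mulr0 ?mul0r ?mul0r //
     |exists y; rewrite ?inE ?eqxx ?orbT // E ?mulr0 ?mul0r ?mul0r //
     |exists z; rewrite ?inE ?eqxx ?orbT // E ?mulr0 ?mul0r ?mul0r //].
Qed.

(** A square root of [q] is at most [q], so a bounded search decides between case (I) and the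
    others. *)
Lemma is_squareP (q : nat) :
  reflect (is_square q) [exists s : 'I_q.+1, q == s ^ 2]%N.
Proof.
apply: (iffP existsP) => [[s /eqP qs]|[s qs]]; first by exists s.
have sq : (s < q.+1)%N.
  by rewrite ltnS qs -mulnn; case: s {qs} => // s; apply: leq_pmulr.
by exists (Ordinal sq); apply/eqP.
Qed.

Lemma nonsquare_sextic q a1 a2 a3 xs : ~ is_square q ->
  has_traces q 3 (sextic q a1 a2 a3) xs -> has_real_root (sextic q a1 a2 a3) ->
  exists h0 : {poly int}, weil_poly q 1 h0 /\
    sextic q a1 a2 a3 = ('X^2 - (q%:Z)%:P) ^+ 2 * h0.
Proof.
move=> nsq T /(real_rootP _ _ _ _ T).
have /sextic_traces[x [y [z [-> [xi yi zi] tr]]]] := T.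
move=> /trace_boundary3 bd.
have [a2E a3E] : a2 = - q%:Z /\ a3 = - (2 * q%:Z * a1).
  (* Both equalities in (d) have this shape, with [eps] equal to 2 for the lower bound and -2 for
     the upper one. *)
  suff [eps [eps0 /(nonsquare_indep _ _ _ nsq)[+ /eqP]]] :
    exists eps : int, eps != 0 /\
      (a3 + 2 * q%:Z * a1)%:~R + (eps * (a2 + q%:Z))%:~R * sqrtC q%:R = 0 :> algC.
    move/eqP; rewrite addr_eq0 => /eqP->.
    by rewrite mulf_eq0 (negPf eps0) addr_eq0 => /eqP->.
  have [[_ _ u3] [_ _ v3]] := cubic_traces_shift _ _ _ _ _ _ _ _ tr.
  move: bd; rewrite u3 v3 sqrtCK => -[] E; [exists 2 | exists (- 2)]; split=> //.
    by rewrite -E !rmorphD /= !rmorphM /= -!pmulrn; ring.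
  by rewrite -[0]oppr0 -E !rmorphD /= !rmorphM /= -!pmulrn; ring.
exists ('X^2 + a1%:P * 'X + (q%:Z)%:P); split; last first.
  by rewrite /sextic a2E a3E; ring.
apply/weil_polyP; split=> //; exists [:: - (a1%:~R)]; split=> //; last first.
  rewrite big_seq1 /trace_quad !rmorphD /= !rmorphM /= !map_polyC map_polyX /=.
  by rewrite -pmulrn; ring.
rewrite /= andbT.
(* The cubic of the traces is now (X + a1)(X^2 - 4q), so - a1 is one of [x], [y], [z] and inherits
   their bounds. *)
have /eqP : (- a1%:~R - x) * (- a1%:~R - y) * (- a1%:~R - z) = 0.
  case: tr; rewrite a2E a3E sqrtCK !rmorphN !rmorphM /= -!pmulrn.
  set Q : algC := q%:R; set A : algC := a1%:~R => E1 E2 E3.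
  have e2 : x * y + x * z + y * z = - (4 * Q).
    by rewrite -[LHS](addKr (3 * Q)) -E2; ring.
  have e3 : x * y * z = 4 * Q * A.
    by rewrite -[LHS](subKr (2 * Q * A)) -E3; ring.
  rewrite (_ : _ * _ = - A ^+ 2 * (A + (x + y + z))
    - (x * y + x * z + y * z) * A - x * y * z); last by ring.
  by rewrite e2 e3 [in X in _ * X]E1; ring.
by rewrite !mulf_eq0 !subr_eq0 => /orP[/orP[]|] /eqP->.
Qed.

Theorem theoremA (p q : nat) (a1 a2 a3 : int) :
  prime p -> (exists n : nat, (0 < n)%N /\ q = (p ^ n)%N) ->
  let h : {poly int} :=
    'X^6 + a1%:P * 'X^5 + a2%:P * 'X^4 + a3%:P * 'X^3
    + (a2 * q%:Z)%:P * 'X^2 + (a1 * (q%:Z) ^+ 2)%:P * 'X + ((q%:Z) ^+ 3)%:P in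
  let A1 : algC := a1%:~R in
  let A2 : algC := a2%:~R in
  let A3 : algC := a3%:~R in
  let Q : algC := q%:R in
  let sq : algC := sqrtC Q in
  let D : algC := A1 ^+ 2 - 3 * A2 + 9 * Q in
  let c0 : algC := - (2 / 27) * A1 ^+ 3 + (1 / 3) * A1 * A2 + Q * A1 in
  (* (a) *) let Ca := `|A1| <= 6 * sq in
  (* (b* ) *) let Cbs := 4 * sq * `|A1| - 9 * Q <= A2 in
  (* (b) *) let Cb := A2 <= (1 / 3) * A1 ^+ 2 + 3 * Q in
  (* (c) *) let Cc := c0 - (2 / 27) * sqrtC D ^+ 3 <= A3 /\
                      A3 <= c0 + (2 / 27) * sqrtC D ^+ 3 in
  (* (d) *) let Cd := - 2 * Q * A1 - 2 * sq * A2 - 2 * Q * sq <= A3 /\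
                      A3 <= - 2 * Q * A1 + 2 * sq * A2 + 2 * Q * sq in
  [/\ (weil_poly q 3 h <-> [/\ Ca, Cbs, Cb, Cc & Cd]),
      (weil_poly q 3 h ->
        (has_real_root h <->
          [\/ `|A1| = 6 * sq,
              4 * sq * `|A1| - 9 * Q = A2,
              - 2 * Q * A1 - 2 * sq * A2 - 2 * Q * sq = A3 |
              A3 = - 2 * Q * A1 + 2 * sq * A2 + 2 * Q * sq]))
    & (weil_poly q 3 h /\ has_real_root h <->
        exists k l : nat,
          [\/ (~ is_square q /\
                 exists h0 : {poly int}, weil_poly q 1 h0 /\
                   h = ('X^2 - (q%:Z)%:P) ^+ 2 * h0),
              (exists s : nat, q = (s ^ 2)%N /\ (k + l = 3)%N /\
                 h = ('X + (s%:Z)%:P) ^+ (2 * k) * ('X - (s%:Z)%:P) ^+ (2 * l)),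
              (exists s : nat, q = (s ^ 2)%N /\ (k + l = 2)%N /\
                 exists h0 : {poly int}, weil_poly q 1 h0 /\ ~ has_real_root h0 /\
                   h = ('X + (s%:Z)%:P) ^+ (2 * k) * ('X - (s%:Z)%:P) ^+ (2 * l) * h0) |
              (exists s : nat, q = (s ^ 2)%N /\ (k + l = 1)%N /\
                 exists h0 : {poly int}, weil_poly q 2 h0 /\ ~ has_real_root h0 /\
                   h = ('X + (s%:Z)%:P) ^+ (2 * k) * ('X - (s%:Z)%:P) ^+ (2 * l) * h0)])].
Proof.
move=> _ _ h A1 A2 A3 Q sq D c0 Ca Cbs Cb Cc Cd.
have s0 : 0 <= sq := sqrtCn_ge0 q.
have intr_real (a : int) : a%:~R \is @Num.real algC := realz _ a.
have [A1r A2r A3r] := And3 (intr_real a1) (intr_real a2) (intr_real a3).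
have boundary xs : has_traces q 3 h xs -> has_real_root h <->
    [\/ `|A1| = 6 * sq, 4 * sq * `|A1| - 9 * Q = A2,
        - 2 * Q * A1 - 2 * sq * A2 - 2 * Q * sq = A3 |
        A3 = - 2 * Q * A1 + 2 * sq * A2 + 2 * Q * sq].
  move=> T; have /sextic_traces[x [y [z [xsE [xi yi zi] tr]]]] := T.
  apply: (iff_trans (real_rootP _ _ _ _ T)); rewrite xsE.
  apply: (iff_trans (trace_boundary3 _ _ _ _)); apply: iff_sym.
  have := boundary_traceP _ _ _ _ _ A1r x y z xi yi zi tr.
  by rewrite [sq ^+ 2]sqrtCK.
split.
- have := cubic_tracesP _ _ s0 _ _ _ A1r A2r A3r; rewrite [sq ^+ 2]sqrtCK.
  apply: iff_trans; apply: (iff_trans (weil_polyP _ _ _)); split.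
    by case=> _ [xs /sextic_traces[x [y [z [_ [xi yi zi] tr]]]]]; exists x, y, z.
  case=> x [y [z [xi yi zi tr]]]; split=> //; exists [:: x; y; z].
  by apply/sextic_traces; exists x, y, z.
- by move=> /weil_polyP[_ [xs /boundary]].
split.
  case=> /weil_polyP[_ [xs T]] rr.
  have [[s qs]|nsq] := is_squareP q; last first.
    (* Case (I) does not mention [k] and [l], so they get dummy values. *)
    by exists 0%N, 0%N; constructor 1; split=> //; apply: nonsquare_sextic T rr.
  have Ts : has_traces (s ^ 2) 3 h xs by rewrite -qs.
  have [k [l [g [h0 [klg hE T0 nr]]]]] := endpoint_decomposition _ _ _ _ Ts.
  have kl_gt0 : (0 < k + l)%N.
    rewrite lt0n addn_eq0; apply/negP => /andP[/eqP k0 /eqP l0].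
    by case: nr; move: rr; rewrite hE k0 l0 /endpoint_pow !expr0 !mul1r.
  rewrite -qs in T0; exists k, l.
  (* The number of traces left in [h0] selects the case: 0, 1, 2 give (II), (III), (IV), and 3 or
     more contradicts [kl_gt0]. *)
  case: g klg T0 => [|[|[|g]]] klg [ys T0].
  - constructor 2; exists s; split=> //; split; first by lia.
    by rewrite hE (has_traces0_inv _ _ _ T0) mulr1.
  - constructor 3; exists s; split=> //; split; first by lia.
    by exists h0; split=> //; apply/weil_polyP; split=> //; exists ys.
  - constructor 4; exists s; split=> //; split; first by lia.
    by exists h0; split=> //; apply/weil_polyP; split=> //; exists ys.
  by lia.
(* Treats (II), (III) and (IV) at once; [g < 3] ensures that a factor with root s or -s is
   present. *)
have square_case s k l g h0 ys : q = (s ^ 2)%N -> (k + l + g = 3)%N -> (g < 3)%N ->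
    has_traces q g h0 ys -> h = endpoint_pow s k l * h0 ->
    weil_poly q 3 h /\ has_real_root h.
  move=> qs klg g3 T0 hE; split; last by rewrite hE; apply: endpoint_pow_root; lia.
  have [zs Tz] := endpoint_pow_traces s k l; rewrite -qs in Tz.
  apply/weil_polyP; split=> //; exists (zs ++ ys).
  by rewrite -klg hE; apply: has_tracesM.
case=> k [l [|||]].
- case=> nsq [h0 [/weil_polyP[_ [ys T0]] hE]].
  have T := has_tracesM _ _ _ _ _ _ _ (sqr_sub_traces q) T0; rewrite -hE in T.
  split; first by apply/weil_polyP; split=> //; eexists; exact: T.
  apply/(real_rootP _ _ _ _ T); exists (2 * sqrtC q%:R).
    by rewrite mem_head.
  by rewrite subrr mul0r.
- case=> s [qs [kl hE]].
  apply: (square_case s k l 0%N 1 [::]) => //; rewrite ?addn0 //.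
    exact: has_traces1.
  by rewrite mulr1.
- case=> s [qs [kl [h0 [/weil_polyP[_ [ys T0]] [_ hE]]]]].
  by apply: (square_case s k l 1%N h0 ys) => //; rewrite kl.
- case=> s [qs [kl [h0 [/weil_polyP[_ [ys T0]] [_ hE]]]]].
  by apply: (square_case s k l 2%N h0 ys) => //; rewrite kl.
Qed.
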